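(* Let $G=(U,V;E)$ be a finite bipartite graph with edge weights $w\colon E\to\mathbb{R}$ such that distinct matchings of $G$ have distinct total weights. For $U'\subseteq U$, let $\mathrm{MM}(G,w;U')$ be the unique maximum-weight matching in the induced subgraph $G[U'\cup V]$, and let $F(U')=\{v\in V\mid (u,v)\in \mathrm{MM}(G,w;U')\text{ for some }u\}$. Let $\mathcal{F}=\{F(U')\mid U'\subseteq U\}$. Then $(V,\mathcal{F})$ is an antimatroid.
   Context: A matching is a set of edges no two of which share a vertex; its weight is the sum of its edge weights. $G[U'\cup V]$ is the subgraph of $G$ induced by $U'\cup V$. A set system $(V,\mathcal{F})$ with $\mathcal{F}\subseteq 2^V$ is an antimatroid if $\mathcal{F}\neq\emptyset$, every nonempty $X\in\mathcal{F}$ has an element $e\in X$ with $X\setminus\{e\}\in\mathcal{F}$ (accessibility), and $X,Y\in\mathcal{F}$ implies $X\cup Y\in\mathcal{F}$ (union-closedness). *)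

(* Defs.v *)
From mathcomp Require Import all_boot all_order all_algebra.
From mathcomp Require Import reals.
Set Implicit Arguments.
Unset Strict Implicit.
Unset Printing Implicit Defensive.
Import Order.TTheory GRing.Theory Num.Theory.
Local Open Scope ring_scope.

(* A finite bipartite graph (U, V; E) is given by two finite types U and V
   (hence disjoint vertex classes) and its edge set E : {set U * V}.  Edge
   weights are total functions on U * V; only their values on E matter. *)

Section BipartiteMatching.
Variables (R : realType) (U V : finType).
Implicit Types (E M : {set U * V}) (w : U * V -> R).

Definition share_vertex (e f : U * V) : bool := (e.1 == f.1) || (e.2 == f.2).

Definition matching E M : bool :=
  (M \subset E) &&
  [forall e in M, forall f in M, (e != f) ==> ~~ share_vertex e f].

Definition weight w M : R := \sum_(e in M) w e.

(* Edge set of the subgraph induced by U' :|: V'. *)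
Definition induced_edges E (U' : {set U}) (V' : {set V}) : {set U * V} :=
  [set e in E | (e.1 \in U') && (e.2 \in V')].

Definition distinct_matching_weights E w : Prop :=
  forall M1 M2, matching E M1 -> matching E M2 -> M1 <> M2 ->
    weight w M1 <> weight w M2.

(* The empty matching is only the witness that [arg max] ranges over a nonempty
   set; see MM_max and MM_unique. *)
Definition MM E w (U' : {set U}) : {set U * V} :=
  [arg max_(M > set0 | matching (induced_edges E U' setT) M) weight w M]%O.

Definition covered E w (U' : {set U}) : {set V} :=
  [set v | [exists u, (u, v) \in MM E w U']].

Definition covered_family E w : {set {set V}} :=
  [set covered E w U' | U' : {set U}].

Lemma matching0 E : matching E set0.
Proof. by rewrite /matching sub0set; apply/forall_inP => e; rewrite inE. Qed.

Lemma MM_max E w U' :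
  matching (induced_edges E U' setT) (MM E w U') /\
  forall M, matching (induced_edges E U' setT) M ->
    weight w M <= weight w (MM E w U').
Proof.
by rewrite /MM; case: arg_maxP => [|M mM maxM]; [exact: matching0 | split].
Qed.

Lemma MM_unique E w U' M : distinct_matching_weights E w ->
  matching (induced_edges E U' setT) M ->
  (forall M', matching (induced_edges E U' setT) M' ->
     weight w M' <= weight w M) ->
  M = MM E w U'.
Proof.
move=> dw mM maxM; have [mMM maxMM] := MM_max E w U'.
have sub N : matching (induced_edges E U' setT) N -> matching E N.
  case/andP=> sN dN; rewrite /matching dN andbT (subset_trans sN) //.
  by apply/subsetP => e; rewrite inE => /andP[].
apply/eqP/negP => /negP/eqP /(dw _ _ (sub _ mM) (sub _ mMM)); apply.
by apply/eqP; rewrite eq_le maxMM // maxM.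
Qed.

End BipartiteMatching.

Definition antimatroid (T : finType) (F : {set {set T}}) : Prop :=
  [/\ F <> set0,
      forall X, X \in F -> X <> set0 -> exists2 e, e \in X & X :\ e \in F
    & forall X Y, X \in F -> Y \in F -> X :|: Y \in F].

(* Main.v *)
(** Linear programming duality turns the family into a family of markets: [X] is
    covered by a maximum-weight matching iff some matching [M] onto [X] admits
    nonnegative item prices, vanishing off [X], at which every matched agent gets
    an item it likes best.  Accessibility: lowering all prices on [X] by their
    minimum keeps [M] supported, and an item whose price is now zero can be dropped
    along with its owner.  Union: take the pointwise maximum of the two price
    vectors and give each item to its owner in the market where it was more
    expensive; an agent that would receive two items contradicts its own
    preferences.  The prices come from shortest paths in the exchange digraph on the
    items plus a dummy item; uniqueness of the optimum makes them positive on [X]. *)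
Require Import Defs.
From mathcomp Require Import all_boot all_order all_algebra.
From mathcomp Require Import reals.
From mathcomp Require Import perm lra.
Set Implicit Arguments.
Unset Strict Implicit.
Unset Printing Implicit Defensive.
Import Order.TTheory GRing.Theory Num.Theory.
Local Open Scope ring_scope.

(** * Shortest-path potentials for arc costs without negative cycles *)

Section Potential.
Variables (R : realDomainType) (T : finType) (c : T -> T -> R).

Fixpoint path_cost x s : R :=
  if s is y :: s' then c x y + path_cost y s' else 0.

Lemma path_cost_cat x s1 s2 :
  path_cost x (s1 ++ s2) = path_cost x s1 + path_cost (last x s1) s2.
Proof. by elim: s1 x => [|y s1 IH] x /=; rewrite ?add0r // IH addrA. Qed.

(** The closing vertex [x0] stays independent of [y] for the induction; [x0 := y] gives a cycle. *)
Lemma sum_next_at x0 y s : uniq (y :: s) ->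
  \sum_(i <- y :: s) c i (next_at i x0 y s) = path_cost y (rcons s x0).
Proof.
elim: s y => [|z s IH] y; first by rewrite big_seq1 /= eqxx addr0.
rewrite cons_uniq => /andP[ys us]; rewrite big_cons /= eqxx; congr (_ + _).
rewrite -IH // !big_seq; apply: eq_bigr => i izs.
by case: eqP => // iy; rewrite -iy izs in ys.
Qed.

Hypotheses (cxx : forall x, c x x = 0)
  (c_perm : forall s : {perm T}, 0 <= \sum_x c x (s x)).

(** A simple cycle extends to a permutation fixing all other points, at no cost by [cxx]. *)
Lemma cycle_cost_ge0 x s : uniq (x :: s) -> 0 <= path_cost x (rcons s x).
Proof.
move=> us; have nextI := can_inj (prev_next us).
have := c_perm (perm nextI); rewrite (bigID (mem (x :: s))) /= addrC big1 => [|y].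
  rewrite add0r -sum_next_at // -big_uniq //=.
  by under eq_bigr do rewrite permE.
by move=> ys; rewrite permE next_nth (negPf ys) cxx.
Qed.

Lemma min_simple_path x : exists s, uniq (x :: s) /\
  forall s', uniq (x :: s') -> path_cost x s <= path_cost x s'.
Proof.
(* Simple paths have bounded length, so a finite type of tuples contains them all and a minimum
   exists. *)
pose P := {k : 'I_#|T|.+1 & k.-tuple T}.
pose tag (k : 'I_#|T|.+1) (t : k.-tuple T) : P := Tagged (fun k : 'I_#|T|.+1 => k.-tuple T) t.
pose t0 := tag ord0 (nil_tuple T).
pose v (t : P) : seq T := tval (tagged t).
have : exists2 t, uniq (x :: v t) &
    forall t', uniq (x :: v t') -> path_cost x (v t) <= path_cost x (v t').
  by exists [arg min_(t < t0 | uniq (x :: v t)) path_cost x (v t)]%O; case: arg_minP.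
case=> t ut mint; exists (v t); split=> // s us.
have sz : (size s < #|T|.+1)%N.
  have /andP[_ /card_uniqP <-] := us; exact: max_card.
exact: mint (tag (Ordinal sz) (in_tuple s)) us.
Qed.

(** [q x] is the least cost of a simple path from [x] with free endpoint. Prepending [x] to the best
    path from [y] gives a simple path, or closes a cycle that can be cut off without raising the
    cost. *)
Lemma potential_exists : exists q : T -> R, forall x y, q x <= c x y + q y.
Proof.
have [f fP] := fin_all_exists min_simple_path.
exists (fun x => path_cost x (f x)) => x y.
have [_ minx] := fP x; have [uy _] := fP y.
have [xy|xy] := boolP (x \in y :: f y); last first.
  by apply: (minx (y :: f y)); rewrite cons_uniq xy.
case/splitPr def_y: {1}_ / xy => [s1 s2]; rewrite def_y in uy.
have -> : c x y + path_cost y (f y) = path_cost x (rcons s1 x ++ s2).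
  by rewrite cat_rcons -def_y.
move: uy; rewrite uniq_catC /= mem_cat cat_uniq => /and4P[].
rewrite negb_or => /andP[xs2 xs1] us2 _ us1.
rewrite path_cost_cat last_rcons.
apply: le_trans (minx s2 _) _; first by rewrite /= xs2.
by rewrite lerDr cycle_cost_ge0 //= xs1.
Qed.

End Potential.

(** * Matchings supported by prices, and weak duality *)

Section Prices.
Variables (R : realType) (U V : finType) (E : {set U * V}) (w : U * V -> R).
Implicit Types (M N : {set U * V}) (p : V -> R).

Lemma matchingP (D M : {set U * V}) :
  reflect [/\ M \subset D, {in M &, injective fst} & {in M &, injective snd}]
          (matching D M).
Proof.
rewrite /matching; apply: (iffP andP) => [[sM /forall_inP dM]|[sM i1 i2]].
  have dj e f : e \in M -> f \in M -> share_vertex e f -> e = f.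
    move=> eM fM sh; apply/eqP/negP => /negP ne.
    by have /forall_inP/(_ f fM) := dM e eM; rewrite ne sh.
  by split=> // e f eM fM ef; apply: dj; rewrite // /share_vertex ef eqxx ?orbT.
split=> //; apply/forall_inP => e eM; apply/forall_inP => f fM.
apply/implyP; apply: contra; rewrite /share_vertex.
by case/orP => /eqP ef; apply/eqP; [apply: i1 | apply: i2].
Qed.

Definition items M : {set V} := [set e.2 | e in M].

Lemma itemsP M v : reflect (exists u, (u, v) \in M) (v \in items M).
Proof.
apply: (iffP imsetP) => [[[u v'] ? /= ->]|[u uv]]; first by exists u.
by exists (u, v).
Qed.

Lemma covered_items (U' : {set U}) : covered E w U' = items (MM E w U').
Proof.
by apply/setP => v; rewrite inE; apply/existsP/itemsP => -[u uv]; exists u.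
Qed.

(** Agents unmatched by [M] are unconstrained: [U'] will be the set of agents that [M] matches. *)
Definition supports M p : Prop :=
  [/\ forall v, 0 <= p v,
      forall v, v \notin items M -> p v = 0,
      forall u v, (u, v) \in M -> p v <= w (u, v)
    & forall u v v', (u, v) \in M -> (u, v') \in E ->
        p v + w (u, v') <= w (u, v) + p v'].

Lemma weight_le_supported M p N : matching E M -> supports M p ->
  matching (induced_edges E [set e.1 | e in M] setT) N -> weight w N <= weight w M.
Proof.
move=> /matchingP[_ M1 M2] [p0 pV pw pd] /matchingP[/subsetP sN N1 N2].
(* The utility of [u], a sum of at most one term; [ut] and [p] form a dual solution of value
   [weight w M]. *)
pose ut u := \sum_(e in M | e.1 == u) (w e - p e.2).
have ut0 u : 0 <= ut u.
  by apply: sumr_ge0 => -[a b] /andP[/= ab _]; rewrite subr_ge0 pw.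
have utE e : e \in M -> ut e.1 = w e - p e.2.
  move=> eM; rewrite /ut (big_pred1 e) // => f /=.
  apply/andP/eqP => [[fM /eqP fe]|->]; last by [].
  exact: M1.
have Nle e : e \in N -> w e <= ut e.1 + p e.2.
  case: e => u v' /sN; rewrite !inE => /and3P[uv' /imsetP[[u1 v] uv /= uu] _].
  rewrite -{}uu in uv; have := pd _ _ _ uv uv'.
  by have /= -> := utE _ uv; lra.
apply: (@le_trans _ _ (\sum_(e in N) (ut e.1 + p e.2))).
  exact: ler_sum.
rewrite big_split /= -(big_imset ut N1) -(big_imset p N2) /=.
have -> : weight w M = \sum_u ut u + \sum_v p v.
  rewrite (bigID (mem (items M)) predT p) /= (big_imset p M2) /=.
  rewrite [\sum_(v | _ \notin _) _]big1 // addr0 /ut -(partition_big fst predT) //= -big_split /=.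
  by apply: eq_bigr => e _; rewrite subrK.
by apply: lerD; [rewrite [leRHS](bigID (mem [set e.1 | e in N])) |
  rewrite [leRHS](bigID (mem (items N)))] => /=; rewrite lerDl sumr_ge0.
Qed.

Lemma matching_induced (U' : {set U}) M :
  matching (induced_edges E U' setT) M -> matching E M.
Proof.
case/matchingP=> sM M1 M2; apply/matchingP; split=> //.
by apply: subset_trans sM _; apply/subsetP => e; rewrite inE => /andP[].
Qed.

Lemma matching_sub (D M N : {set U * V}) : matching D M -> N \subset M -> matching D N.
Proof.
case/matchingP=> sM M1 M2 sN; apply/matchingP; split; first exact: subset_trans sM.
- by apply: sub_in2 M1; apply/subsetP.
- by apply: sub_in2 M2; apply/subsetP.
Qed.

Hypothesis hw : distinct_matching_weights E w.

Lemma supported_in_family M p : matching E M -> supports M p ->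
  items M \in covered_family E w.
Proof.
move=> mM sMp; apply/imsetP; exists [set e.1 | e in M] => //.
rewrite covered_items; congr items; apply: MM_unique => // [|N].
  case/matchingP: mM => /subsetP sM M1 M2; apply/matchingP; split=> //.
  by apply/subsetP => e eM; rewrite !inE sM // imset_f.
exact: weight_le_supported mM sMp.
Qed.

(** * Prices for the unique optimum *)

Lemma MM_gap (U' : {set U}) : exists2 d : R, 0 < d &
  forall N, matching (induced_edges E U' setT) N -> N != MM E w U' ->
    weight w N + d <= weight w (MM E w U').
Proof.
have [mM maxM] := MM_max E w U'; set M := MM E w U' in mM maxM *.
pose P N := matching (induced_edges E U' setT) N && (N != M).
have [N0 PN0|P0] := pickP P; last first.
  by exists 1 => // N mN NM; have := P0 N; rewrite /P mN NM.
have [N1 /andP[mN1 NM1] max1] : exists2 N1, P N1 &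
    forall N, P N -> weight w N <= weight w N1.
  by exists [arg max_(N > N0 | P N) weight w N]%O; case: arg_maxP.
(* The lead over the runner-up [N1]. *)
exists (weight w M - weight w N1) => [|N mN NM].
  rewrite subr_gt0 lt_neqAle maxM // andbT; apply/eqP.
  by apply: hw; [exact: matching_induced mN1|exact: matching_induced mM|apply/eqP].
by rewrite -lerBrDr opprB addrC subrK max1 // /P mN.
Qed.

Lemma MM_edge_ge0 (U' : {set U}) e : e \in MM E w U' -> 0 <= w e.
Proof.
move=> eM; have [mM maxM] := MM_max E w U'.
have /maxM := matching_sub mM (subsetDl (MM E w U') [set e]).
by rewrite /weight [leRHS](big_setD1 e) //= lerDr.
Qed.

(* Nonedges and edges of negative weight can be given weight zero without
   changing the optimum; the exchange digraph then becomes complete. *)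
Definition gain u (j : option V) : R :=
  if j is Some v then if (u, v) \in E then Num.max 0 (w (u, v)) else 0 else 0.

(** The owner of [v] moves to [s (Some v)], and goes unmatched if that is the dummy, a nonedge or an
    edge of negative weight, where [gain] is 0. The last clause serves to show that the result
    differs from [M]. *)
Lemma permuted_matching (D M : {set U * V}) (s : {perm option V}) :
  matching D M -> D \subset E ->
  (forall e v, e \in M -> (e.1, v) \in E -> (e.1, v) \in D) ->
  exists N, [/\ matching D N,
    weight w N = \sum_(e in M) gain e.1 (s (Some e.2))
    & forall e, e \in M -> s (Some e.2) != Some e.2 -> e \notin N].
Proof.
case/matchingP=> /subsetP sM M1 M2 /subsetP sD DE.
pose phi e : U * V := (e.1, odflt e.2 (s (Some e.2))).
pose M' := [set e in M | [&& s (Some e.2) != None, phi e \in E & 0 <= w (phi e)]].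
have sM' e : e \in M' -> e \in M by rewrite inE => /andP[].
have phiS e : e \in M' -> s (Some e.2) = Some (phi e).2.
  by rewrite inE /phi; case: (s _) => //=; rewrite andbF.
have phiI : {in M' &, injective phi}.
  by move=> e f /sM' eM /sM' fM [ef _]; apply: M1.
exists (phi @: M'); split.
- apply/matchingP; split.
  + apply/subsetP => f /imsetP[e]; rewrite inE => /and4P[eM _ ? _] ->.
    exact: DE.
  + move=> _ _ /imsetP[e /sM' eM ->] /imsetP[f /sM' fM ->] /= ef.
    by rewrite (M1 _ _ eM fM ef).
  + move=> _ _ /imsetP[e eM ->] /imsetP[f fM ->] ef.
    congr phi; apply: M2; rewrite ?sM' //.
    apply: Some_inj; apply: (@perm_inj _ s).
    by rewrite !phiS // ef.
- rewrite /weight (big_imset w phiI) /= [LHS]big_mkcond [RHS]big_mkcond /=.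
  apply: eq_bigr => e _; rewrite inE /phi /gain.
  case: (e \in M) => //=; case: (s _) => //= v; case: (_ \in E) => //=.
  by case: leP.
- move=> e eM ne; apply/negP => /imsetP[f fM ef].
  have fe : f = e by apply: (M1 _ _ (sM' _ fM) eM); rewrite ef.
  by move: ne; rewrite -[in s _]fe phiS // -ef eqxx.
Qed.

Lemma MM_prices (U' : {set U}) : exists2 p, supports (MM E w U') p &
  forall v, v \in items (MM E w U') -> 0 < p v.
Proof.
have [mM maxM] := MM_max E w U'; have [d d0 gap] := MM_gap U'.
have MM0 := @MM_edge_ge0 U'.
set M := MM E w U' in mM gap MM0 maxM *.
have [/subsetP sM M1 M2] := matchingP _ _ mM.
have ME e : e \in M -> e \in E by move/sM; rewrite inE => /andP[].
(* The gain of the owner of [i] from [j]; the dummy and unsold items have no owner and get 0. The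
   arc cost [c i j] is the owner's loss, discounted by [d] on arcs from the dummy to sold items. *)
pose g i j := if i is Some v then \sum_(e in M | e.2 == v) gain e.1 j else 0.
pose b (i j : option V) := (i == None) && (if j is Some v then v \in items M else false).
pose c i j := g i i - g i j - d *+ b i j.
have gE u v j : (u, v) \in M -> g (Some v) j = gain u j.
  move=> uv; rewrite /g (big_pred1 (u, v)) // => f /=.
  apply/andP/eqP => [[fM /eqP fv]|->]; last by rewrite eqxx.
  exact: M2.
have gainM u v : (u, v) \in M -> gain u (Some v) = w (u, v).
  by move=> uv; rewrite /gain ME // max_r // MM0.
have cxx i : c i i = 0.
  by rewrite /c subrr /b; case: i => [v|] /=; rewrite subr0.
have sum_option (F : option V -> R) : \sum_i F i = F None + \sum_v F (Some v).
  rewrite (bigD1 None) //=; congr (_ + _).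
  rewrite (reindex_omap Some id) => [|[]//].
  by apply: eq_bigl => v; rewrite eqxx.
have sumg (s : option V -> option V) :
    \sum_i g i (s i) = \sum_(e in M) gain e.1 (s (Some e.2)).
  rewrite sum_option add0r [RHS](partition_big snd predT) //=.
  by apply: eq_bigr => v _; apply: eq_bigr => e /andP[_ /eqP->].
have cperm (s : {perm option V}) : 0 <= \sum_i c i (s i).
  have [||N [mN wN NM]] := @permuted_matching (induced_edges E U' setT) M s mM.
  - by apply/subsetP => e; rewrite inE => /andP[].
  - by move=> e v /sM; rewrite !inE => /and3P[_ -> _] ->.
  rewrite /c sumrB sumrB (sumg id) sumg -wN.
  have -> : \sum_(e in M) gain e.1 (Some e.2) = weight w M.
    by apply: eq_bigr => -[u v] /gainM.
  rewrite sum_option big1 => [|v _]; last by rewrite /b.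
  rewrite addr0 /b eqxx /=; case sN: (s None) => [v|]; last first.
    by rewrite subr0 subr_ge0 maxM.
  have [/itemsP[u uv]|_] := boolP (v \in items M); last first.
    by rewrite subr0 subr_ge0 maxM.
  (* As [s] sends the dummy to [v], it moves [v]; so [N] differs from [M] and the gap pays for the
     only discount. *)
  rewrite mulr1n -addrA -opprD subr_ge0 gap //.
  apply: contraTneq (uv) => <-; apply: NM => //=.
  by apply/eqP => sv; have := perm_inj (etrans sN (esym sv)).
have [q qP] := potential_exists cxx cperm.
(* Prices are relative to the dummy; the discounted arc to a sold item gives a price of at least
   [d]. *)
exists (fun v => q (Some v) - q None) => [|v vM]; last first.
  have := qP None (Some v); rewrite /c /g /b /= vM mulr1n; lra.
split=> [v|v vM|u v uv|u v v' uv uv'].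
- have := qP None (Some v); rewrite /c /g /b /=.
  by case: (v \in items M); rewrite ?mulr1n ?mulr0n; lra.
- have := qP None (Some v); have := qP (Some v) None.
  rewrite /c /b /= (negPf vM) /g !big1 => [|e|e]; rewrite ?mulr0n; first lra.
    by case/andP=> eM /eqP ev; rewrite -ev imset_f in vM.
  by case/andP=> eM /eqP ev; rewrite -ev imset_f in vM.
- have := qP (Some v) None.
  by rewrite /c !(gE u) // gainM // /b /= mulr0n; lra.
- have := qP (Some v) (Some v'); rewrite /c !(gE u) // gainM // /b /= mulr0n uv'.
  have : w (u, v') <= Num.max 0 (w (u, v')) by rewrite le_max lexx orbT.
  lra.
Qed.

(** * Accessibility and union-closedness through prices *)

Lemma family_prices X : X \in covered_family E w ->
  exists M p, [/\ matching E M, supports M p, X = items M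
                & forall v, v \in X -> 0 < p v].
Proof.
case/imsetP=> U' _ ->; rewrite covered_items.
have [p sp pp] := MM_prices U'; exists (MM E w U'), p; split=> //.
by apply: (@matching_induced U'); case: (MM_max E w U').
Qed.

Lemma family_accessible X : X \in covered_family E w -> X <> set0 ->
  exists2 v, v \in X & X :\ v \in covered_family E w.
Proof.
case/family_prices=> M [p [mM [p0 pV pw pd] XM _]] /eqP/set0Pn[v0 v0X].
have [v vX minv] : exists2 v, v \in X & forall v', v' \in X -> p v <= p v'.
  by exists [arg min_(v < v0 in X) p v]%O; case: arg_minP.
exists v => //; pose N := [set e in M | e.2 != v].
have -> : X :\ v = items N.
  rewrite XM; apply/setP => v'; rewrite !inE; apply/andP/itemsP.
    by case=> v'v /itemsP[u uv']; exists u; rewrite inE uv'.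
  by case=> u; rewrite inE => /andP[uv' v'v]; split=> //; apply/itemsP; exists u.
apply: (@supported_in_family _ (fun v' => if v' \in X then p v' - p v else 0)).
  by apply: matching_sub mM _; apply/subsetP => e; rewrite inE => /andP[].
have pv0 : 0 <= p v by [].
split=> [v'|v' v'N|u v1|u v1 v2].
- by case: ifP => // /minv; rewrite subr_ge0.
- case: ifP => // v'X; have [->|v'v] := eqVneq v' v; first by rewrite subrr.
  case/negP: v'N; move: v'X; rewrite XM => /itemsP[u uv'].
  by apply/itemsP; exists u; rewrite inE uv'.
- rewrite inE => /andP[uv1 _]; have -> : v1 \in X by rewrite XM; apply/itemsP; exists u.
  by have := pw _ _ uv1; lra.
- rewrite inE => /andP[uv1 _]; have -> : v1 \in X by rewrite XM; apply/itemsP; exists u.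
  (* Inside [X] both prices drop equally; outside, the price stays 0 while the owned item gets no
     dearer. *)
  move=> uv2; have := pd _ _ _ uv1 uv2; case: ifPn => [_|]; first lra.
  by rewrite XM => /pV ->; lra.
Qed.

Lemma family_union X Y : X \in covered_family E w -> Y \in covered_family E w ->
  X :|: Y \in covered_family E w.
Proof.
case/family_prices=> M [p [mM [p0 pV pw pd] XM _]].
case/family_prices=> N [q [mN [q0 qV qw qd] YN qpos]].
pose L := [set e in M | q e.2 <= p e.2] :|: [set e in N | p e.2 < q e.2].
have LP u v : (u, v) \in L ->
    ((u, v) \in M) /\ (q v <= p v) \/ ((u, v) \in N) /\ (p v < q v).
  by rewrite !inE /= => /orP[/andP[]|/andP[]]; [left|right].
have [[/subsetP sM M1 M2] [/subsetP sN N1 N2]] := (matchingP _ _ mM, matchingP _ _ mN).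
(* Adding the two preference inequalities of [u] gives [p v + q v' <= p v' + q v]. *)
have no_clash u v v' : (u, v) \in M -> q v <= p v -> (u, v') \in N -> p v' < q v' -> False.
  move=> uv qp uv' pq.
  by have := pd _ _ _ uv (sN _ uv'); have := qd _ _ _ uv' (sM _ uv); lra.
have -> : X :|: Y = items L.
  apply/setP => v; rewrite inE; apply/idP/itemsP => [|[u /LP]]; last first.
    by rewrite XM YN => -[] [uv _]; apply/orP; [left|right]; apply/itemsP; exists u.
  have [qp XY|pq XY] := leP (q v) (p v).
    (* Ties go to [M], so an item of [Y] must be sold there: [p v] is at least [q v], which is
       positive on [Y]. *)
    have : v \in items M.
      case/orP: XY => [|vY]; first by rewrite XM.
      have := qpos _ vY; apply: contraTT => /pV pv0.
      by rewrite -leNgt -pv0.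
    by case/itemsP=> u uv; exists u; rewrite !inE uv qp.
  have : v \in items N.
    by apply: contraTT pq => /qV ->; rewrite -leNgt.
  by case/itemsP=> u uv; exists u; rewrite !inE uv /= pq orbT.
apply: (@supported_in_family _ (fun v => Num.max (p v) (q v))).
  apply/matchingP; split.
  - by apply/subsetP => -[u v] /LP [][? _]; [apply: sM|apply: sN].
  - move=> [u v] [u' v'] /LP uv /LP uv' /= uu; rewrite -{u'}uu in uv' *.
    case: uv uv' => -[uv pq] [] [uv' pq'].
    + exact: M1.
    + by case: (no_clash u v v').
    + by case: (no_clash u v' v).
    + exact: N1.
  - move=> [u v] [u' v'] /LP uv /LP uv' /= vv; rewrite -{v'}vv in uv' *.
    case: uv uv' => -[uv pq] [] [uv' pq']; first exact: M2.
    + by rewrite leNgt pq' in pq.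
    + by rewrite leNgt pq in pq'.
    + exact: N2.
split=> [v|v vL|u v|u v v'].
- by rewrite le_max p0.
- have [qp|pq] := leP (q v) (p v).
    apply: pV; apply: contra vL => /itemsP[u uv].
    by apply/itemsP; exists u; rewrite !inE uv qp.
  apply: qV; apply: contra vL => /itemsP[u uv].
  by apply/itemsP; exists u; rewrite !inE uv /= pq orbT.
- by case/LP => -[uv]; [move/max_l-> | move/ltW/max_r->]; auto.
(* The owner keeps its old price, while the price of any alternative can only rise. *)
- have : p v' <= Num.max (p v') (q v') by rewrite le_max lexx.
  have : q v' <= Num.max (p v') (q v') by rewrite le_max lexx orbT.
  move=> ? ? /LP[] [uv]; [move/max_l-> | move/ltW/max_r->] => uv'.
    by have := pd _ _ _ uv uv'; lra.
  by have := qd _ _ _ uv uv'; lra.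
Qed.

End Prices.

Theorem theorem2 (R : realType) (U V : finType) (E : {set U * V})
    (w : U * V -> R) (hw : distinct_matching_weights E w) :
  antimatroid (covered_family E w).
Proof.
split; [|exact: family_accessible|exact: family_union].
by apply/eqP/set0Pn; exists (covered E w set0); apply: imset_f.
Qed.
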